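(* Let $e>r\ge 3$ be integers and let $\mu$ be a composition of $r$ of length $j$ (so $1\le j\le r$). Then the set $\mathcal{W}_{r,e}(\mu)$ forms the lattice points of a $(j-1)$-dimensional simplex of dilation factor $e-j$.
   Context: Partitions and abaci. A composition of $r$ is a finite sequence of positive integers with sum $r$; its length is the number of its terms. A partition is a finite weakly decreasing sequence $\lambda=(\lambda_1,\lambda_2,\dots)$ of positive integers, with $\ell(\lambda)$ parts; set $\lambda_i=0$ for $i>\ell(\lambda)$. If $\ell(\lambda)\le r$, its $r$-beta numbers are $\beta_i(\lambda)=\lambda_i+r-i$ for $1\le i\le r$; this is a strictly decreasing sequence of non-negative integers, and every strictly decreasing sequence of $r$ non-negative integers arises from a unique partition of length at most $r$. The $e$-abacus of $\lambda$ (with $r$ beads) has runners $0,1,\dots,e-1$ and rows $0,1,2,\dots$; the bead $\beta_i(\lambda)=ae+b$ with $0\le b\le e-1$ is placed in row $a$ of runner $b$. Weights. Let $P=\bigoplus_{i=1}^{r-1}\mathbb{Z}\Lambda_i$ be the weight lattice of $\mathfrak{sl}_r$, with fundamental weights $\Lambda_1,\dots,\Lambda_{r-1}$. For a partition $\lambda$ with $\ell(\lambda)\le r$ put $\Omega(\lambda)=\sum_{i=1}^{r-1}(\beta_i(\lambda)-\beta_{i+1}(\lambda))\Lambda_i$. The set $\mathcal{W}_{r,e}(\mu)$. For a composition $\mu=(\mu_1,\dots,\mu_j)$ of $r$, let $\mathscr{P}_{r,e}(\mu)$ be the set of partitions whose $e$-abacus with $r$ beads is obtained as follows: choose runners $0\le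 s_1<\cdots<s_j\le e-1$ and, for each $i$, place $\mu_i$ beads in rows $0,1,\dots,\mu_i-1$ of runner $s_i$; all other positions are empty. Put $\mathcal{W}_{r,e}(\mu)=\Omega(\mathscr{P}_{r,e}(\mu))$. Simplices. For integers $d\ge 0$, $L>0$ let $\Delta^d(L)=\{(x_0,\dots,x_d)\in\mathbb{R}_{\ge 0}^{d+1}: x_0+\cdots+x_d=L\}$. A subset $S\subset P$ ''forms the lattice points of a $d$-dimensional simplex of dilation factor $L$'' if there is an affine linear map $\phi:\mathbb{R}^{d+1}\to P\otimes\mathbb{R}$ (a linear map plus a constant vector) whose restriction to the hyperplane $\{x_0+\cdots+x_d=L\}$ is injective and such that $S=\phi(\Delta^d(L)\cap\mathbb{Z}^{d+1})$. *)

(* Defs.v *)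
From HB Require Import structures.
From mathcomp Require Import all_boot all_order all_algebra.
From mathcomp Require Import mathcomp_extra boolp classical_sets functions reals.

Set Implicit Arguments.
Unset Strict Implicit.
Unset Printing Implicit Defensive.

Import Order.TTheory GRing.Theory Num.Theory.

Local Open Scope classical_set_scope.
Local Open Scope ring_scope.

Definition is_composition (r : nat) (mu : seq nat) : Prop :=
  (0 \notin mu)%N /\ sumn mu = r.

Definition is_partition (la : seq nat) : Prop :=
  sorted geq la /\ (0 \notin la)%N.

(* As in the usual convention, i runs over 1, ..., r, and the parts beyond the
   length of la are 0; the subtraction is exact on this range. *)
Definition beta_number (r : nat) (la : seq nat) (i : nat) : nat :=
  (nth 0 la i.-1 + r - i)%N.

(* A position on the abacus is a pair (row, runner). *)
Definition abacus (e r : nat) (la : seq nat) : set (nat * nat) :=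
  [set p | exists2 i, (1 <= i <= r)%N &
             p = ((beta_number r la i %/ e)%N, (beta_number r la i %% e)%N)].

(* The weight lattice of sl_r, in coordinates with respect to the fundamental
   weights: the ordinal i stands for the index i + 1, so that Lambda i is the
   (i+1)-st fundamental weight. *)
Definition weight_lattice (r : nat) := 'rV[int]_r.-1.

Definition Lambda (r : nat) (i : 'I_r.-1) : weight_lattice r := delta_mx 0 i.

Definition Omega (r : nat) (la : seq nat) : weight_lattice r :=
  \sum_(i < r.-1)
     ((beta_number r la i.+1)%:Z - (beta_number r la i.+2)%:Z) *: (Lambda i : 'rV[int]_r.-1).

Definition partitions_of_shape (r e : nat) (mu : seq nat) : set (seq nat) :=
  [set la | [/\ is_partition la, (size la <= r)%N &
    exists s : seq nat,
      [/\ size s = size mu, sorted ltn s, all (fun b => b < e)%N s &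
          abacus e r la =
          [set p | exists2 i, (i < size mu)%N &
                     (p.1 < nth 0 mu i)%N /\ p.2 = nth 0%N s i]]]].

Definition weights_of_shape (r e : nat) (mu : seq nat) :
  set (weight_lattice r) :=
  Omega r @` partitions_of_shape r e mu.

Arguments weights_of_shape : clear implicits.

Definition hyperplane (R : realType) (d L : nat) : set 'rV[R]_d.+1 :=
  [set x : 'rV[R]_d.+1 | \sum_i x 0 i = L%:R].

Definition simplex (R : realType) (d L : nat) : set 'rV[R]_d.+1 :=
  [set x : 'rV[R]_d.+1 | (forall i, 0 <= x 0 i) /\ \sum_i x 0 i = L%:R].

Definition lattice_points (R : realType) (n : nat) : set 'rV[R]_n :=
  [set x : 'rV[R]_n | forall i, x 0 i \is a Num.int].

Definition is_affine (R : realType) (m n : nat) (phi : 'rV[R]_m -> 'rV[R]_n) :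
  Prop :=
  exists (f : {linear 'rV[R]_m -> 'rV[R]_n}) (c : 'rV[R]_n),
    forall x, phi x = f x + c.

(* The inclusion of the weight lattice P in P tensor R = R^(r-1). *)
Definition weight_real (R : realType) (r : nat) (w : weight_lattice r) :
  'rV[R]_r.-1 := map_mx intr (w : 'rV[int]_r.-1).

(* The conjunct 0 < L is the standing condition on dilation factors; it also
   rules out a factor e - j arising from truncated subtraction. *)
Definition forms_simplex_lattice_points (R : realType) (r d L : nat)
    (W : set (weight_lattice r)) : Prop :=
  (0 < L)%N /\
  exists phi : 'rV[R]_d.+1 -> 'rV[R]_r.-1,
    [/\ is_affine phi,
        set_inj (@hyperplane R d L) phi &
        @weight_real R r @` W =
          phi @` (@simplex R d L `&` @lattice_points R d.+1)].

(* Main.v *)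
(* Beads of smaller row come first, and within a row beads are ordered by
   runner, so the order of the beads depends only on mu and not on the chosen
   runners s_1 < ... < s_j.  Hence every beta number is a constant plus some
   s_i, and the weight is an affine function of the gaps x_i = s_{i+1} - s_i - 1
   (1 <= i < j).  Only the gaps matter: together with the remaining slack x_0
   they are arbitrary non-negative integers with sum e - j.  As every part of mu
   is positive, row 0 contains a bead on each chosen runner, so the j - 1 gaps
   can be read off the smallest beta numbers: this gives injectivity. *)

Require Import Defs.
From mathcomp Require Import all_boot all_order all_algebra.
From mathcomp Require Import reals.
From mathcomp Require Import classical_sets functions zify ring.

Import Order.TTheory GRing.Theory Num.Theory.

(** * Partitions and their beta numbers *)

(** Zeros of a weakly decreasing sequence form a tail, where the default value of [nth] replaces
    them. *)
Lemma nth_filter_neq0 (s : seq nat) (m : nat) :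
  sorted geq s -> nth 0 [seq x <- s | x != 0] m = nth 0 s m.
Proof.
elim: s m => [|x s IHs] m //= path_s.
have sorted_s := path_sorted path_s.
have [x0|xn0] /= := eqVneq x 0; last by case: m => //= m; apply: IHs.
have s0 y : y \in s -> y = 0.
  have geq_trans : transitive geq by move=> a b c /= ba ac; apply: leq_trans ba.
  move=> ys; have /allP /(_ y ys) /= := order_path_min geq_trans path_s.
  by rewrite x0; case: y {ys}.
have -> : [seq y <- s | y != 0] = [::].
  by apply/eqP; rewrite -[_ == _]negbK -has_filter; apply/hasPn => y /s0 ->.
rewrite nth_nil.
case: m => [|m] //=; have [ms|sm] := ltnP m (size s); last by rewrite nth_default.
by rewrite [RHS]s0 ?mem_nth.
Qed.

(** Makes the subtraction of [r - i] from a beta number exact in [nat]. *)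
Lemma leq_nth_ltn_sorted (B : seq nat) (m : nat) :
  sorted ltn B -> m < size B -> m <= nth 0 B m.
Proof.
move=> sB; elim: m => [|m IHm] // mB.
apply: (leq_ltn_trans (IHm (ltnW mB))).
by apply: (sorted_ltn_nth ltn_trans 0 sB) => //; rewrite inE // ltnW.
Qed.

Lemma partition_of_beta_numbers (r : nat) (B : seq nat) :
  sorted ltn B -> size B = r ->
  exists2 la, is_partition la /\ size la <= r &
    forall i, 0 < i <= r -> beta_number r la i = nth 0 B (r - i).
Proof.
move=> sB szB.
(* [B] increases while beta numbers decrease, so it is read backwards; [part m] is the part of index
   [m + 1]. *)
pose part m := nth 0 B (r - m.+1) - (r - m.+1).
have sorted_part : sorted geq (mkseq part r).
  apply/(sortedP 0) => i; rewrite size_mkseq => ir.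
  rewrite /= !nth_mkseq // ?(ltnW ir) // /part.
  have -> : r - i.+1 = (r - i.+2).+1 by lia.
  have : nth 0 B (r - i.+2) < nth 0 B (r - i.+2).+1.
    by apply: (sorted_ltn_nth ltn_trans 0 sB) => //; rewrite inE; lia.
  by lia.
exists [seq x <- mkseq part r | x != 0].
  split; first split.
  - by apply: sorted_filter sorted_part => a b c /= ba ac; apply: leq_trans ba.
  - by rewrite mem_filter.
  - by rewrite size_filter (leq_trans (count_size _ _)) // size_mkseq.
case=> // i /= ir.
rewrite /beta_number nth_filter_neq0 // nth_mkseq // /part.
have := leq_nth_ltn_sorted B (r - i.+1) sB; rewrite szB /=; lia.
Qed.

(** A strictly increasing list is determined by its members, so the set of beta numbers fixes each
    of them. *)
Lemma beta_number_unique (r : nat) (la B : seq nat) :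
  is_partition la -> sorted ltn B ->
  (forall b, (b \in B) <-> exists2 i, 0 < i <= r & b = beta_number r la i) ->
  size B = r /\ forall i, 0 < i <= r -> beta_number r la i = nth 0 B (r - i).
Proof.
move=> [sla _] sB memB.
pose bs := mkseq (fun m => beta_number r la (r - m)) r.
have sbs : sorted ltn bs.
  apply/(sortedP 0) => i; rewrite size_mkseq => ir.
  rewrite /= !nth_mkseq // ?(ltnW ir) // /beta_number.
  have : nth 0 la (r - i).-1 <= nth 0 la (r - i.+1).-1; last by lia.
  have [ila|ila] := ltnP (r - i).-1 (size la); last by rewrite nth_default.
  have geq_trans : transitive geq by move=> a b c /= ba ac; apply: leq_trans ba.
  apply: (sorted_leq_nth geq_trans _ 0 sla); rewrite ?inE; [exact: leqnn | lia..].
have -> : B = bs.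
  apply: (irr_sorted_eq ltn_trans ltnn sB sbs) => b; apply/idP/idP.
    move=> /memB[i ir ->]; apply/mapP; exists (r - i); first by rewrite mem_iota; lia.
    by congr beta_number; lia.
  move=> /mapP[m]; rewrite mem_iota => mr ->; apply/memB; exists (r - m) => //; lia.
rewrite size_mkseq; split=> // i ir; rewrite nth_mkseq; last by lia.
by congr beta_number; lia.
Qed.

(** * Occupied slots and their beads *)

(* The slot k = a * j + i stands for row a of the i-th chosen runner; the
   numerical order of the slots is the order of the corresponding beads. *)
Definition slots (mu : seq nat) : seq nat :=
  [seq k <- iota 0 (sumn mu * size mu) | k %/ size mu < nth 0 mu (k %% size mu)].

Definition bead (e j : nat) (s : seq nat) (k : nat) : nat :=
  k %/ j * e + nth 0 s (k %% j).

Lemma leq_nth_sumn (mu : seq nat) (i : nat) : nth 0 mu i <= sumn mu.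
Proof.
elim: mu i => [|x mu IH] [|i] //=; first exact: leq_addr.
exact: (leq_trans (IH i) (leq_addl _ _)).
Qed.

Lemma leq_size_sumn (mu : seq nat) : 0 \notin mu -> size mu <= sumn mu.
Proof.
elim: mu => [|[|x] mu IH] //=; rewrite inE /= => /IH; lia.
Qed.

(** Double count of pairs (row, runner): exactly [nth 0 mu i] of the first [sumn mu] rows are
    occupied on runner [i]. *)
Lemma size_slots (mu : seq nat) : size (slots mu) = sumn mu.
Proof.
rewrite size_filter -sum1_count big_mkcond /=.
have -> : iota 0 (sumn mu * size mu) = index_iota 0 (sumn mu * size mu).
  by rewrite /index_iota subn0.
rewrite big_nat_mul.
rewrite (eq_bigr (fun a => \sum_(0 <= i < size mu) if a < nth 0 mu i then 1 else 0)).
  rewrite exchange_big /= [RHS]sumnE [RHS](big_nth 0); apply: eq_big_nat => i _.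
  rewrite -big_mkcond /= sum1_count -size_filter -[RHS](size_iota 0); congr size.
  apply: (irr_sorted_eq ltn_trans ltnn).
  - exact: sorted_filter ltn_trans _ _ (iota_ltn_sorted _ _).
  - exact: iota_ltn_sorted.
  - move=> a; rewrite mem_filter mem_index_iota mem_iota.
    by have := leq_nth_sumn mu i; lia.
move=> a _; rewrite -{1}[a * size mu]add0n big_addn mulSn addnK.
apply: eq_big_nat => i /andP[_ ij].
rewrite addnC divnMDl ?(leq_ltn_trans _ ij) // (divn_small ij) addn0.
by rewrite modnMDl (modn_small ij).
Qed.

Lemma sorted_slots (mu : seq nat) : sorted ltn (slots mu).
Proof. exact: sorted_filter ltn_trans _ _ (iota_ltn_sorted _ _). Qed.

(** Every part is positive, so no slot of row 0 is filtered out, and these slots come first. *)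
Lemma nth_slots_lt (mu : seq nat) (m : nat) :
  0 \notin mu -> m < size mu -> nth 0 (slots mu) m = m.
Proof.
move=> mu0 mj.
have j_gt0 : 0 < size mu by apply: leq_ltn_trans mj.
have le_j : size mu <= sumn mu * size mu.
  by rewrite leq_pmull // (leq_trans j_gt0) // leq_size_sumn.
rewrite /slots -(subnKC le_j) iotaD filter_cat nth_cat.
have -> : [seq k <- iota 0 (size mu) | k %/ size mu < nth 0 mu (k %% size mu)]
          = iota 0 (size mu).
  apply/all_filterP/allP => k; rewrite mem_iota => /andP[_ kj].
  rewrite divn_small // modn_small // lt0n.
  by apply: contraNneq mu0 => <-; rewrite mem_nth.
by rewrite size_iota mj nth_iota.
Qed.

(** Within a row the order is that of [s]; a later row adds at least [e], more than two runners can
    differ. *)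
Lemma ltn_bead (e : nat) (s : seq nat) :
  0 < size s -> sorted ltn s -> all (fun b => b < e) s ->
  {homo bead e (size s) s : k l / k < l}.
Proof.
move=> s_gt0 ss se k l kl; rewrite /bead.
have lt_e m : nth 0 s (m %% size s) < e.
  by apply: (allP se); rewrite mem_nth // ltn_pmod.
have := leq_div2r (size s) (ltnW kl); rewrite leq_eqVlt => /predU1P[eq_row|lt_row].
  rewrite -eq_row ltn_add2l.
  apply: (sorted_ltn_nth ltn_trans 0 ss); rewrite ?inE ?ltn_pmod //.
  by move: kl; rewrite {1}(divn_eq k (size s)) {1}(divn_eq l (size s)) eq_row ltn_add2l.
have := lt_e k; have := leq_mul2r e (k %/ size s).+1 (l %/ size s).
by rewrite lt_row orbT mulSn; lia.
Qed.

Lemma mem_beads (e : nat) (mu s : seq nat) (b : nat) :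
  size s = size mu -> all (fun b => b < e) s ->
  b \in [seq bead e (size s) s k | k <- slots mu] <->
  exists2 i, i < size mu & b %/ e < nth 0 mu i /\ b %% e = nth 0 s i.
Proof.
move=> szs se; split.
  move=> /mapP[k]; rewrite mem_filter mem_iota /= => /andP[lt_mu lt_k] ->.
  have j_gt0 : 0 < size mu by case: (size mu) lt_k; rewrite ?muln0.
  exists (k %% size mu); first exact: ltn_pmod.
  have lt_e : nth 0 s (k %% size mu) < e.
    by apply: (allP se); rewrite mem_nth // szs ltn_pmod.
  have e_gt0 := leq_ltn_trans (leq0n _) lt_e.
  by rewrite /bead szs divnMDl // (divn_small lt_e) addn0 modnMDl (modn_small lt_e).
case=> i ij [lt_mu eq_s]; apply/mapP; exists (b %/ e * size mu + i).
  rewrite mem_filter mem_iota /= divnMDl ?(leq_ltn_trans _ ij) //.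
  rewrite (divn_small ij) addn0 modnMDl (modn_small ij) lt_mu /=.
  have : (b %/ e).+1 * size mu <= sumn mu * size mu.
    by rewrite leq_mul2r (leq_trans lt_mu) ?orbT // leq_nth_sumn.
  by rewrite mulSn; lia.
rewrite /bead szs divnMDl ?(leq_ltn_trans _ ij) //.
by rewrite (divn_small ij) addn0 modnMDl (modn_small ij) -eq_s -divn_eq.
Qed.

(** * Partitions of shape [mu] and choices of runners *)

Definition has_runners (e j : nat) (s : seq nat) : Prop :=
  [/\ size s = j, sorted ltn s & all (fun b => b < e) s].

(** Slots are listed in increasing order, so the i-th largest bead has index [sumn mu - i]. *)
Definition beta_of_runners (e : nat) (mu s : seq nat) (i : nat) : nat :=
  bead e (size s) s (nth 0 (slots mu) (sumn mu - i)).

Lemma partitions_of_shapeP (e : nat) (mu s : seq nat) :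
  0 < size mu -> has_runners e (size mu) s ->
  exists2 la, partitions_of_shape (sumn mu) e mu la &
    forall i, 0 < i <= sumn mu ->
      beta_number (sumn mu) la i = beta_of_runners e mu s i.
Proof.
move=> j_gt0 [szs ss se].
have szB : size [seq bead e (size s) s k | k <- slots mu] = sumn mu.
  by rewrite size_map size_slots.
have sB : sorted ltn [seq bead e (size s) s k | k <- slots mu].
  apply: homo_sorted (sorted_slots mu); apply: ltn_bead => //; by rewrite szs.
have [la [pla szla] beta_la] := partition_of_beta_numbers _ _ sB szB.
exists la; last first.
  move=> i ir; rewrite beta_la // (nth_map 0) // size_slots; lia.
split=> //; exists s; split=> //.
apply/seteqP; split=> [p [i ir ->]|[a b] /= [i ij [lt_mu eq_b]]] /=.
  apply/(mem_beads e mu s) => //; rewrite beta_la // mem_nth // szB; lia.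
have lt_e : b < e by rewrite eq_b (allP se) // mem_nth // szs.
have e_gt0 := leq_ltn_trans (leq0n _) lt_e.
have : a * e + b \in [seq bead e (size s) s k | k <- slots mu].
  apply/mem_beads => //; exists i => //.
  by rewrite divnMDl // divn_small // addn0 modnMDl modn_small.
move=> /(nthP 0)[m]; rewrite szB => mr eq_m.
exists (sumn mu - m); first by lia.
rewrite beta_la; last by lia.
have -> : sumn mu - (sumn mu - m) = m by lia.
by rewrite eq_m divnMDl // divn_small // addn0 modnMDl modn_small.
Qed.

Lemma partitions_of_shape_inv (e : nat) (mu la : seq nat) :
  0 < size mu -> partitions_of_shape (sumn mu) e mu la ->
  exists2 s, has_runners e (size mu) s &
    forall i, 0 < i <= sumn mu ->
      beta_number (sumn mu) la i = beta_of_runners e mu s i.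
Proof.
move=> j_gt0 [pla szla [s [szs ss se abacus_la]]]; exists s => //.
have sB : sorted ltn [seq bead e (size s) s k | k <- slots mu].
  apply: homo_sorted (sorted_slots mu); apply: ltn_bead => //; by rewrite szs.
have e_gt0 : 0 < e.
  have s0s : nth 0 s 0 \in s by rewrite mem_nth // szs.
  exact: leq_ltn_trans (leq0n _) (allP se _ s0s).
have memB b : b \in [seq bead e (size s) s k | k <- slots mu] <->
    exists2 i, 0 < i <= sumn mu & b = beta_number (sumn mu) la i.
  rewrite mem_beads //.
  have -> : (exists2 i, i < size mu & b %/ e < nth 0 mu i /\ b %% e = nth 0 s i)
            = abacus e (sumn mu) la (b %/ e, b %% e) by rewrite abacus_la.
  split=> -[i ir]; last by move=> ->; exists i.
  by case=> eq_div eq_mod; exists i; rewrite // (divn_eq b e) eq_div eq_mod -divn_eq.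
have [_ beta_la] := beta_number_unique _ _ _ pla sB memB.
move=> i ir; rewrite beta_la // (nth_map 0) // size_slots; lia.
Qed.

(** * Partial sums of gaps and coordinates of weights *)

Local Open Scope ring_scope.
Local Open Scope classical_set_scope.

(** The sum starts at 1 because coordinate 0 is the slack; [V] is general so as to cover real
    coordinates and their natural-number values. *)
Definition partial_sum (V : nmodType) (d : nat) (g : 'I_d.+1 -> V) (i : nat) : V :=
  \sum_(l < d.+1 | (0 < l <= i)%N) g l.

Lemma partial_sumS (V : nmodType) (d : nat) (g : 'I_d.+1 -> V) (i : nat)
    (lt_id : (i.+1 < d.+1)%N) :
  partial_sum V d g i.+1 = g (Ordinal lt_id) + partial_sum V d g i.
Proof.
rewrite /partial_sum (bigD1 (Ordinal lt_id)) /=; last by rewrite leqnn.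
by congr (_ + _); apply: eq_bigl => l; rewrite -val_eqE /=; lia.
Qed.

Lemma partial_sum_max (V : nmodType) (d : nat) (g : 'I_d.+1 -> V) :
  \sum_l g l = g ord0 + partial_sum V d g d.
Proof.
rewrite (bigD1 ord0) //=; congr (_ + _); apply: eq_bigl => l.
by rewrite -val_eqE /= -lt0n leq_ord andbT.
Qed.

Lemma OmegaE (r : nat) (la : seq nat) :
  Omega r la = \row_i ((beta_number r la i.+1)%:Z - (beta_number r la i.+2)%:Z).
Proof.
apply/rowP => i; rewrite /Omega summxE mxE (bigD1 i) //= big1 ?addr0.
  by rewrite !mxE !eqxx mulr1.
by move=> l /negPf li; rewrite !mxE [i == l]eq_sym li andbF mulr0.
Qed.

(** * The affine map from the simplex to the weights *)

Section WeightMap.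

Variables (R : realType) (e d : nat) (mu : seq nat).
Hypotheses (mu0 : 0%N \notin mu) (size_mu : size mu = d.+1).

Let r := sumn mu.

(** Coordinate [i] of a weight compares beta numbers [i + 1] and [i + 2], whose slots are [upper i]
    and [lower i]. *)
Let upper (i : 'I_r.-1) : nat := nth 0%N (slots mu) (r - i.+1).
Let lower (i : 'I_r.-1) : nat := nth 0%N (slots mu) (r - i.+2).

(** Bead in slot [k] when the runners are 0, 1, ..., d, that is, when all gaps vanish. *)
Let base (k : nat) : nat := (k %/ d.+1 * e + k %% d.+1)%N.

(* In barycentric coordinates x the i-th runner sits at i + x_1 + ... + x_i
   relative to the first one, and x_0 is the slack on the abacus. *)
Definition weight_map_linear : 'M[R]_(d.+1, r.-1) :=
  \matrix_(l, i) ((0 < l <= upper i %% d.+1)%N%:R - (0 < l <= lower i %% d.+1)%N%:R).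

Definition weight_map (x : 'rV[R]_d.+1) : 'rV[R]_r.-1 :=
  x *m weight_map_linear + \row_i ((base (upper i))%:R - (base (lower i))%:R).

Lemma weight_map_affine : is_affine weight_map.
Proof.
exists (mulmxr weight_map_linear : {linear 'rV[R]_d.+1 -> 'rV[R]_r.-1}).
by eexists => x; rewrite /weight_map /=.
Qed.

Lemma mulmx_weight_map (x : 'rV[R]_d.+1) (i : 'I_r.-1) :
  (x *m weight_map_linear) 0 i =
  partial_sum R d (x 0) (upper i %% d.+1) - partial_sum R d (x 0) (lower i %% d.+1).
Proof.
rewrite mxE /partial_sum [X in X - _]big_mkcond [X in _ - X]big_mkcond /= -sumrB.
by apply: eq_bigr => l _; rewrite mxE; do 2 case: ifP => _; rewrite /= ?mulr0n ?mulr1n; ring.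
Qed.

(* The beads of row 0 give the gaps between consecutive runners. *)
Lemma weight_map_inj (L : nat) : set_inj (@hyperplane R d L) weight_map.
Proof.
move=> x y /set_mem xL /set_mem yL /addIr eq_xy.
have eq_gap l : l != ord0 -> x 0 l = y 0 l.
  case: l => [[//|l] lt_ld] _.
  have le_dr : (d.+1 <= r)%N by rewrite -size_mu leq_size_sumn.
  (* This coordinate compares slots [l + 1] and [l] of row 0, so its linear part is the gap of index
     [l + 1]. *)
  have lt_i : (r - l.+2 < r.-1)%N by lia.
  have := congr1 (fun z : 'rV[R]_r.-1 => z 0 (Ordinal lt_i)) eq_xy.
  rewrite /= !mulmx_weight_map /upper /lower /=.
  have -> : (r - (r - l.+2).+1 = l.+1)%N by lia.
  have -> : (r - (r - l.+2).+2 = l)%N by lia.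
  rewrite !nth_slots_lt ?size_mu // ?(ltnW lt_ld) //.
  by rewrite !modn_small ?(ltnW lt_ld) // !partial_sumS !addrK.
apply/rowP => l; have [-> {l}|] := eqVneq l ord0; last exact: eq_gap.
(* Coordinate 0 is forced by the fixed total. *)
move: xL; rewrite /hyperplane /= -yL (bigD1 ord0) //= [RHS](bigD1 ord0) //=.
by rewrite (eq_bigr _ eq_gap) => /addIr.
Qed.

(** Each bead is its [base] plus a partial sum of gaps plus the first runner, which cancels between
    consecutive beta numbers. *)
Lemma weight_map_runners (la s : seq nat) (x : 'rV[R]_d.+1) :
  size s = d.+1 ->
  (forall i, (0 < i <= r)%N -> beta_number r la i = beta_of_runners e mu s i) ->
  (forall i, (i < d.+1)%N ->
     partial_sum R d (x 0) i = (nth 0%N s i)%:R - (nth 0%N s 0)%:R - i%:R) ->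
  weight_map x = @weight_real R r (Omega r la).
Proof.
move=> szs beta_la x_s; rewrite OmegaE; apply/rowP => i.
have ir := ltn_ord i.
rewrite /weight_map mxE mulmx_weight_map !x_s ?ltn_pmod // !mxE.
rewrite !beta_la; [|lia..].
rewrite /beta_of_runners /bead /base szs -/(upper i) -/(lower i).
by rewrite intrB -!pmulrn !natrD; ring.
Qed.

Lemma weight_map_image : (d < e)%N ->
  [set @weight_real R r w | w in weights_of_shape r e mu] =
  [set weight_map x | x in @simplex R d (e - d.+1) `&` @lattice_points R d.+1].
Proof.
move=> lt_de.
have j_gt0 : (0 < size mu)%N by rewrite size_mu.
apply/seteqP; split=> [_ [_ [la la_mu <-] <-]|_ [x [[x_ge0 sum_x] x_int] <-]].
  have [s [szs ss se] beta_la] := partitions_of_shape_inv e mu la j_gt0 la_mu.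
  rewrite size_mu in szs.
  (* Coordinates 1 to [d] count the empty runners between neighbours; coordinate 0 counts those
     before the first or after the last. *)
  pose x : 'rV[R]_d.+1 := \row_l
    if (0 < l)%N then (nth 0%N s l)%:R - (nth 0%N s l.-1)%:R - 1
    else e%:R + (nth 0%N s 0)%:R - (nth 0%N s d)%:R - 1.
  have x_s i : (i < d.+1)%N ->
      partial_sum R d (x 0) i = (nth 0%N s i)%:R - (nth 0%N s 0)%:R - i%:R.
    elim: i => [|i IHi] lt_id.
      by rewrite /partial_sum big_pred0 => [|l]; [ring | lia].
    by rewrite partial_sumS IHi ?(ltnW lt_id) // mxE /= -natr1; ring.
  have lt_s i k : (i < k < d.+1)%N -> (nth 0%N s i < nth 0%N s k)%N.
    by move=> ik; apply: (sorted_ltn_nth ltn_trans 0%N ss); rewrite ?inE; lia.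
  exists x; last exact: weight_map_runners szs beta_la x_s.
  have lt_e i : (i < d.+1)%N -> (nth 0%N s i < e)%N.
    by move=> lt_id; apply: (allP se); rewrite mem_nth // szs.
  split; first split.
  - move=> l; rewrite mxE; case: ifP => l_gt0.
      rewrite -addrA -opprD natr1 subr_ge0 ler_nat; apply: lt_s; have := ltn_ord l; lia.
    rewrite -addrA -opprD natr1 -natrD subr_ge0 ler_nat.
    by have := lt_e d (ltnSn d); lia.
  - rewrite partial_sum_max x_s // mxE /= natrB // -natr1; ring.
  - move=> l; rewrite mxE.
    by case: ifP => _; rewrite ?(rpredB, rpredD, rpred1, intr_nat, natr_int).
(* The coordinates are non-negative integers, so truncation is exact. *)
pose n l := Num.truncn (x 0 l).
have xE l : x 0 l = (n l)%:R.
  by rewrite truncnK // -intrEge0.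
have partial_sum_n i : partial_sum R d (x 0) i = (partial_sum nat d n i)%:R.
  by rewrite /partial_sum natr_sum; apply: eq_bigr => l _.
have partial_sum_mono i k : (i <= k)%N -> (partial_sum nat d n i <= partial_sum nat d n k)%N.
  move=> ik; rewrite /partial_sum big_mkcond [leqRHS]big_mkcond /=.
  apply: leq_sum => l _; case: ifP => // /andP[l_gt0 li].
  by rewrite l_gt0 (leq_trans li ik).
have sum_n : (n ord0 + partial_sum nat d n d = e - d.+1)%N.
  apply/eqP; rewrite -(eqr_nat R) natrD -partial_sum_n -xE -partial_sum_max.
  by rewrite sum_x.
(* The first runner is put at 0 and all slack after the last one; shifting the runners would not
   change the weight. *)
pose s := mkseq (fun i => i + partial_sum nat d n i)%N d.+1.
have runners_s : has_runners e (size mu) s.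
  split; first by rewrite size_mkseq.
    apply/(sortedP 0%N) => i; rewrite size_mkseq => ir.
    rewrite !nth_mkseq ?(ltnW ir) //=.
    by have := partial_sum_mono i i.+1 (leqnSn i); lia.
  apply/allP => b /mapP[i]; rewrite mem_iota => /andP[_ lt_id] ->.
  by have := partial_sum_mono i d; lia.
have [la la_mu beta_la] := partitions_of_shapeP e mu s j_gt0 runners_s.
exists (Omega r la); first by exists la.
apply/esym/(weight_map_runners la s) => //; first by rewrite size_mkseq.
move=> i lt_id; rewrite partial_sum_n !nth_mkseq // natrD.
by rewrite {3}/partial_sum big_pred0 => [|l]; [rewrite addn0; ring | lia].
Qed.

End WeightMap.

Theorem theorem3p6 (R : realType) (e r j : nat) (mu : seq nat)
  (hr : (3 <= r)%N) (he : (r < e)%N)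
  (hmu : is_composition r mu) (hj : size mu = j) :
  forms_simplex_lattice_points R j.-1 (e - j)%N (weights_of_shape r e mu).
Proof.
have [mu0 sum_mu] := hmu; subst r.
have le_jr : (j <= sumn mu)%N by rewrite -hj leq_size_sumn.
(* Length 0 would force the sum 0, contrary to [3 <= r]. *)
case: j hj le_jr => [|d] size_mu le_dr; first by rewrite (size0nil size_mu) in hr.
split; first by lia.
exists (weight_map R e d mu); split.
- exact: weight_map_affine.
- exact: weight_map_inj.
- by apply: weight_map_image => //; lia.
Qed.
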